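(* Let $\gamma$ be a weak composition of length $n$ and let $\lambda=\widetilde{\gamma}$. The map $\Theta$ is a bijection, with inverse $\Theta^{-1}=\tilde\Theta$, between composition array patterns of shape $\gamma$ and Gelfand-Tsetlin patterns of shape $\widetilde{\gamma}=\lambda$. Moreover, the square with sides $\Theta\colon A\to B$, $\psi\colon A\to C$, $\varphi\colon B\to D$, $\theta\colon C\to D$ commutes, i.e. $\varphi\circ\Theta=\theta\circ\psi$, where - $A$ is the set of composition array patterns of shape $\gamma$, - $B$ is the set of Gelfand-Tsetlin patterns of shape $\widetilde{\gamma}=\lambda$, - $C$ is the set of column-strict composition tableaux of shape $\gamma^+$ with first column $\mathcal{F}(\gamma)$, - $D$ is the set of reverse column-strict Young tableaux of shape $\widetilde{\gamma}=\lambda$.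
   Context: For a weak composition $\gamma=(\gamma_1,\dots,\gamma_n)$ (a sequence of nonnegative integers): $\gamma^+$ is obtained by deleting the zero parts; $\widetilde\gamma$ is the partition obtained by placing the parts of $\gamma$ in weakly decreasing order; $\mathcal{F}(\gamma)=\{i\mid\gamma_i>0\}$. Diagrams have left-justified rows, row $i$ from the top having as many boxes as the $i$th part. Composition array pattern of shape $\gamma$: a triangular array $(x_{i,j})$, $1\le i\le n$, $1\le j\le n-i+1$, of nonnegative integers satisfying (1) $\gamma_i=x_{1,i}$; (2) $x_{i,j}\le x_{i-1,j+1}$; and (3) for all $1\le i\le n-1$ and all $0\le r<s\le n-i$, $$(x_{i+1,r}\ge x_{i+1,s}\text{ and }x_{i+1,r}\ge x_{i,s+1})\quad\text{or}\quad(x_{i+1,r}<x_{i+1,s}<x_{i,s+1}\text{ and }x_{i,r+1}<x_{i+1,s}),$$ where $x_{j,0}=0$ for all $j$. Gelfand-Tsetlin pattern of shape $\lambda$: a triangular array $(x_{i,j})$, same index set, of nonnegative integers with first row $\lambda$ and $x_{i,j}\ge x_{i+1,j}\ge x_{i,j+1}$ for all $1\le i\le n-1$, $1\le j\le n-i$. Column-strict composition tableau of shape $\alpha$, where $\alpha$ has $k$ parts (all positive) and largest part $m$: a filling $U$ of the diagram of $\alpha$ with positive integers such that (1) the first column strictly increases from top to bottom; (2) each row weakly decreases from left to right; (3) with $\hat U$ the $k\times m$ array obtained from $U$ by adding zeros at the ends of rows, for $1\le i_1<i_2\le k$ and $2\le j\le m$: if $\hat U(i_2,j)\ne0$ and $\hat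 U(i_2,j)\ge\hat U(i_1,j)$, then $\hat U(i_2,j)>\hat U(i_1,j-1)$. ''First column $\mathcal F(\gamma)$'' means that the set of entries of the first column is $\mathcal F(\gamma)$. Reverse column-strict Young tableau of shape $\lambda$: a filling of the diagram of $\lambda$ with positive integers whose rows weakly decrease from left to right and whose columns strictly decrease from top to bottom. The maps: - $\Theta$ sorts each row of a composition array pattern into weakly decreasing order. - $\tilde\Theta$ transforms a Gelfand-Tsetlin pattern into a new triangular array, row by row from row $n$ up to row $1$. Row $n$ is fixed. Inductively, the entries of row $i$ of the pattern are taken from least to greatest and each is placed in the unoccupied position $(i,k)$, $k>1$, as far to the right as possible such that the entry of the new array at position $(i+1,k-1)$ is weakly less than the entry being placed; if no such position with $k>1$ exists, the entry is placed in position $(i,1)$. - $\psi$: given a composition array pattern $(x_{i,j})$ of shape $\gamma$, for $i=n,n-1,\dots,1$ fill with the entry $i$ those boxes of the diagram of $(x_{i,1},\dots,x_{i,n-i+1})$ which are not in the diagram of $(x_{i+1,1},\dots,x_{i+1,n-i})$, the latter being placed in the lower left corner of the former (so its $j$th row sits in row $j+1$). This fills the diagram of $\gamma$; deleting empty rows gives a filling of shape $\gamma^+$. - $\varphi$: given a Gelfand-Tsetlin pattern $(x_{i,j})$ of shape $\lambda$, for each $i$ fill the boxes of the skew shape $(x_{i,1},\dots,x_{i,n-i+1})/(x_{i+1,1},\dots,x_{i+1,n-i})$ inside the diagram of $\lambda$ with the entry $i$. - $\theta$: the $i$th column of $\theta(U)$ is the $i$th column of $U$ sorted into strictly decreasing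 order from top to bottom.
   Formalization: The bijection is proved for composition array patterns of all shapes δ with sorted δ equal to λ (for fixed γ it fails, e.g. γ=(1,0)), and condition (3) gains the case x_{i+1,r}<x_{i+1,s}=x_{i,s+1} (otherwise shape (1,1) has no pattern). *)

(* Defs.v *)
From mathcomp Require Import all_boot.

Set Implicit Arguments.
Unset Strict Implicit.
Unset Printing Implicit Defensive.

(* Arrays and fillings of diagrams are both lists of rows.  [entry x i j] is
   x_{i,j} with 1-based indices; it is 0 for j = 0 and outside the array, which
   is the convention x_{i,0} = 0 for patterns and the padding of U to
   \hat U for tableaux. *)
Definition entry (x : seq (seq nat)) (i j : nat) : nat :=
  nth 0 (0 :: nth [::] ([::] :: x) i) j.

(* Row i (1 <= i <= n) has n - i + 1 entries. *)
Definition triangular (n : nat) (x : seq (seq nat)) : Prop :=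
  shape x = rev (iota 1 n).

(* Both the parts of lambda = \tilde gamma and those of gamma keep their zeros:
   they are the first rows of arrays of the same size. *)
Definition sort_decr (s : seq nat) : seq nat := sort geq s.

Definition positive_parts (gamma : seq nat) : seq nat :=
  [seq p <- gamma | 0 < p].

Definition support_set (gamma : seq nat) : seq nat :=
  [seq i <- iota 1 (size gamma) | 0 < nth 0 gamma i.-1].

(* With a = x_{i+1,r}, b = x_{i+1,s}, c = x_{i,s+1}, d = x_{i,r+1}.
   Pitfall: the first two alternatives alone are not enough.  They leave out the
   case a < b = c, in which the row of b receives no box labelled i, so that
   nothing has to be required.  Without the third alternative there would be no
   pattern at all of shape (0,1) or (1,1), and the image of a Gelfand-Tsetlin
   pattern under [Theta_inv] would in general not be a composition array
   pattern. *)
Definition array_condition (a b c d : nat) : Prop :=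
  [\/ b <= a /\ c <= a,
      a < b < c /\ d < b
    | a < b /\ b = c].

Definition comp_array_pattern (gamma : seq nat) (x : seq (seq nat)) : Prop :=
  let n := size gamma in
  [/\ triangular n x,
      forall i, 1 <= i <= n -> nth 0 gamma i.-1 = entry x 1 i,
      forall i j, 2 <= i <= n -> 1 <= j <= n - i + 1 ->
        entry x i j <= entry x i.-1 j.+1
    & forall i r s, 1 <= i <= n.-1 -> r < s -> s <= n - i ->
        array_condition (entry x i.+1 r) (entry x i.+1 s)
                        (entry x i s.+1) (entry x i r.+1)].

(* The shape is only fixed up to rearrangement: the first row of
   [Theta_inv y] depends on the whole pattern y, and for a single gamma
   [Theta] is injective but not onto. *)
Definition comp_array_pattern_sorting_to (lambda : seq nat)
    (x : seq (seq nat)) : Prop :=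
  exists2 delta, sort_decr delta = lambda & comp_array_pattern delta x.

Definition GT_pattern (lambda : seq nat) (x : seq (seq nat)) : Prop :=
  let n := size lambda in
  [/\ triangular n x,
      forall i, 1 <= i <= n -> nth 0 lambda i.-1 = entry x 1 i
    & forall i j, 1 <= i <= n.-1 -> 1 <= j <= n - i ->
        entry x i j.+1 <= entry x i.+1 j <= entry x i j].

(* Entries of the j-th column (1-based), from top to bottom; only the rows
   having at least j boxes contribute. *)
Definition column (T : seq (seq nat)) (j : nat) : seq nat :=
  [seq nth 0 r j.-1 | r <- T & j <= size r].

Definition transpose (T : seq (seq nat)) : seq (seq nat) :=
  [seq column T j | j <- iota 1 (\max_(r <- T) size r)].

Definition comp_tableau (alpha : seq nat) (U : seq (seq nat)) : Prop :=
  [/\ shape U = alpha /\ all (all (ltn 0)) U,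
      sorted ltn (column U 1),
      all (sorted geq) U
    & forall i1 i2 j, 1 <= i1 -> i1 < i2 -> i2 <= size alpha ->
        2 <= j <= \max_(p <- alpha) p ->
        entry U i2 j <> 0 -> entry U i1 j <= entry U i2 j ->
        entry U i1 j.-1 < entry U i2 j].

Definition comp_tableau_first_column (gamma : seq nat)
    (U : seq (seq nat)) : Prop :=
  comp_tableau (positive_parts gamma) U /\ column U 1 =i support_set gamma.

(* The zero parts of lambda have no boxes, hence no row in T. *)
Definition reverse_tableau (lambda : seq nat) (T : seq (seq nat)) : Prop :=
  [/\ shape T = positive_parts lambda,
      all (all (ltn 0)) T,
      all (sorted geq) T
    & all (sorted gtn) (transpose T)].

Definition Theta (x : seq (seq nat)) : seq (seq nat) := map sort_decr x.

(* Places the value v in a partially filled row (None = unoccupied), above the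
   completed row [below].  Positions are 0-based here: position k stands for
   (i, k + 1) and lies above [nth 0 below k.-1], and [last 0] selects the
   rightmost admissible position, or position 0 if there is none. *)
Definition place (below : seq nat) (row : seq (option nat)) (v : nat) :
    seq (option nat) :=
  let admissible k :=
    [&& 0 < k, nth None row k == None & nth 0 below k.-1 <= v] in
  set_nth None row (last 0 [seq k <- iota 0 (size row) | admissible k])
    (Some v).

Definition place_row (below r : seq nat) : seq nat :=
  [seq odflt 0 o
     | o <- foldl (place below) (nseq (size r) None) (sort leq r)].

Fixpoint Theta_inv (y : seq (seq nat)) : seq (seq nat) :=
  match y with
  | [::] => [::]
  | [:: r] => [:: r]
  | r :: y' => let x' := Theta_inv y' in place_row (head [::] x') r :: x'
  end.

(* D i r is the length of row r of the i-th diagram, in a fixed frame of n rows,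
   with the (i+1)-st diagram contained in the i-th one; the boxes of row r which
   are in the i-th but not in the (i+1)-st diagram get the entry i. *)
Definition fill (n : nat) (D : nat -> nat -> nat) : seq (seq nat) :=
  let row r :=
    flatten [seq nseq (D i r - D i.+1 r) i | i <- rev (iota 1 n)] in
  [seq t <- map row (iota 1 n) | t != [::]].

(* Row j of the i-th diagram sits in row i + j - 1 of the diagram of gamma; for
   i > r the index r.+1 - i is 0, which gives an empty row as it should. *)
Definition psi (x : seq (seq nat)) : seq (seq nat) :=
  fill (size x) (fun i r => entry x i (r.+1 - i)).

Definition phi (y : seq (seq nat)) : seq (seq nat) :=
  fill (size y) (entry y).

Definition theta (U : seq (seq nat)) : seq (seq nat) :=
  transpose (map sort_decr (transpose U)).

Definition maps_to (A B : seq (seq nat) -> Prop)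
    (f : seq (seq nat) -> seq (seq nat)) : Prop :=
  forall x, A x -> B (f x).

Definition bijection_with_inverse (A B : seq (seq nat) -> Prop)
    (f g : seq (seq nat) -> seq (seq nat)) : Prop :=
  [/\ maps_to A B f, maps_to B A g,
      forall x, A x -> g (f x) = x & forall y, B y -> f (g y) = y].

(* Main.v *)
(* For consecutive rows b, c of a pattern put B = 0 :: b.  The composition array
   conditions say that B <= c pointwise and that, for r < s with B_s < c_s, either
   c_s <= B_r or c_r < B_s.  In particular the intervals ]B_k, c_k] are disjoint,
   that is, for every t > 0 the number of entries >= t grows by 0 or 1 from b to c,
   which is the interlacing condition for the sorted rows.  Given B and the
   multiset of c, the remaining condition says that for r < s never
   B_s <= c_r < c_s, which is exactly what the greedy placement from least to
   greatest guarantees, and it determines c.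
     On the tableau side, the entry in row r and column j of a filled nested
   family of diagrams D is >= t iff j <= D t r.  Hence the number of entries >= t
   in a column depends only on the multiset of the t-th row of the pattern, so
   the columns of psi x and phi (Theta x) agree up to order. *)

Require Import Defs.
From mathcomp Require Import all_boot zify.

Set Implicit Arguments.
Unset Strict Implicit.
Unset Printing Implicit Defensive.

(** * Sorted sequences of natural numbers *)

(** In a weakly decreasing list the entries [>= t] form a prefix; since [t] is positive, the default
    0 past the end fails the test too. Comparisons of sorted rows thus become comparisons of
    threshold counts. *)
Lemma leq_nth_sort_decr s t j :
  0 < t -> (t <= nth 0 (sort_decr s) j) = (j < count (leq t) s).
Proof.
move=> t_gt0; have /permP <- : perm_eq (sort_decr s) s by rewrite perm_sort.
have : sorted geq (sort_decr s) by apply: sort_sorted => m k; exact: leq_total.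
elim: (sort_decr s) j => [|a r IHr] j /=; first by rewrite nth_nil; lia.
rewrite path_sortedE; last exact: (rev_trans leq_trans).
case/andP=> a_max /IHr{}IHr; case: (leqP t a) => [|a_lt] /=.
  by case: j => [|j] //=; rewrite IHr.
suff r0 : count (leq t) r = 0 by case: j => [|j] /=; rewrite ?IHr ?r0; lia.
apply/eqP; rewrite -leqn0 leqNgt -has_count; apply/hasPn => b /(allP a_max) /=.
lia.
Qed.

Lemma sort_decr_id s : sorted geq s -> sort_decr s = s.
Proof. by apply: sorted_sort; exact: (rev_trans leq_trans). Qed.

Lemma perm_sort_decr s1 s2 : perm_eq s1 s2 -> sort_decr s1 = sort_decr s2.
Proof.
move=> eq_s; apply/perm_sortP => // [m k|k m p /= le_mk le_pm|m k /=].
- exact: leq_total.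
- exact: leq_trans le_pm le_mk.
- by rewrite andbC => /anti_leq.
Qed.

Lemma eq_of_leq m k : (forall t, 0 < t -> (t <= m) = (t <= k)) -> m = k.
Proof.
case: m k => [|m] [|k] eq_mk //; try by move: (eq_mk 1 isT).
by apply/eqP; rewrite eqn_leq -eq_mk // leqnn eq_mk // leqnn.
Qed.

Lemma leq_nth_sorted s j t :
  sorted geq s -> 0 < t -> (t <= nth 0 s j) = (j < count (leq t) s).
Proof. by move=> s_sorted t_gt0; rewrite -leq_nth_sort_decr // sort_decr_id. Qed.

Lemma leq_nth_sort_decr2 s1 s2 j k :
    (forall t, 0 < t -> j < count (leq t) s1 -> k < count (leq t) s2) ->
  nth 0 (sort_decr s1) j <= nth 0 (sort_decr s2) k.
Proof.
case E: (nth 0 (sort_decr s1) j) => [//|t] le_s12.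
by rewrite leq_nth_sort_decr // le_s12 // -leq_nth_sort_decr // E.
Qed.

Lemma sorted_geq_nth s :
  (forall j, nth 0 s j.+1 <= nth 0 s j) -> sorted geq s.
Proof. by move=> s_decr; apply/(sortedP 0) => i _; apply: s_decr. Qed.

Lemma nth_sorted_geq s j : sorted geq s -> nth 0 s j.+1 <= nth 0 s j.
Proof.
move=> /(sortedP 0) s_decr; case: (ltnP j.+1 (size s)) => [/s_decr//|?].
by rewrite nth_default.
Qed.

Lemma sort_decr_sorted s : sorted geq (sort_decr s).
Proof. by apply: sort_sorted => m k; exact: leq_total. Qed.

(** When all entries are positive, the count at threshold 1 is the length, so the counts recover the
    whole multiset. *)
Lemma eq_sort_decr s1 s2 :
    all (ltn 0) s1 -> all (ltn 0) s2 ->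
    (forall t, 0 < t -> count (leq t) s1 = count (leq t) s2) ->
  sort_decr s1 = sort_decr s2.
Proof.
rewrite !all_count => /eqP sz1 /eqP sz2 eq_s12.
apply: (@eq_from_nth _ 0) => [|j _].
  by rewrite !size_sort -sz1 -sz2; apply: (eq_s12 1).
by apply: eq_of_leq => t t_gt0; rewrite !leq_nth_sort_decr ?eq_s12.
Qed.

Lemma count_nth_iota s m t :
    0 < t -> size s <= m ->
  count (fun k => t <= nth 0 s k) (iota 0 m) = count (leq t) s.
Proof.
move=> t_gt0 le_s_m; rewrite -(subnKC le_s_m) iotaD count_cat add0n.
rewrite -[in RHS](mkseq_nth 0 s) /mkseq count_map.
rewrite [X in _ + X](_ : _ = 0) ?addn0 //.
apply/eqP; rewrite -leqn0 leqNgt -has_count; apply/hasPn => k.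
by rewrite mem_iota => /andP[? _]; rewrite nth_default // leqNgt t_gt0.
Qed.

Lemma count_uniq_le1 (T : eqType) (p : pred T) s :
    uniq s -> {in s &, forall a b, p a -> p b -> a = b} -> count p s <= 1.
Proof.
move=> s_uniq p_uniq; rewrite -size_filter.
case E: (filter p s) => [|a [|b r]] //.
have := filter_uniq p s_uniq; rewrite E /= inE.
have: (a \in filter p s) && (b \in filter p s) by rewrite E !inE !eqxx orbT.
rewrite !mem_filter => /andP[/andP[pa sa] /andP[pb sb]].
by rewrite (p_uniq a b) // eqxx.
Qed.

Lemma count_iota_leq a m : count (fun j => j <= a) (iota 1 m) = minn a m.
Proof.
elim: m => [|m IHm]; first by rewrite minn0.
by rewrite -[X in iota _ X]addn1 iotaD count_cat IHm /=; lia.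
Qed.

(** * Consecutive rows *)

Definition interlace (b c : seq nat) : Prop :=
  forall j, nth 0 c j.+1 <= nth 0 b j <= nth 0 c j.

Definition strip (b c : seq nat) : Prop :=
  (forall k, nth 0 (0 :: b) k <= nth 0 c k) /\
  forall r s, r < s -> nth 0 (0 :: b) s < nth 0 c s ->
    nth 0 c s <= nth 0 (0 :: b) r \/ nth 0 c r < nth 0 (0 :: b) s.

(** With [B] for [0 :: b]: if [c_r] were below [c_s] but at least [B_s], it would be placed before
    [c_s], while position [s], further right, was still open to it. *)
Definition greedy (b c : seq nat) : Prop :=
  forall r s, r < s -> nth 0 c r < nth 0 (0 :: b) s \/ nth 0 c s <= nth 0 c r.

Lemma strip_greedy b c : strip b c -> greedy b c.
Proof.
case=> le_bc sep r s lt_rs; have := sep r s lt_rs.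
have := le_bc r; have := le_bc s;
  move: (nth 0 _ _) (nth 0 _ _) (nth 0 _ _) (nth 0 _ _).
lia.
Qed.

(** [count (leq t) s] is the [t]-th part of the conjugate of the sorted list, so the two partitions
    differ by a horizontal strip. *)
Definition one_more (s1 s2 : seq nat) : Prop :=
  forall t, 0 < t -> count (leq t) s1 <= count (leq t) s2 <= (count (leq t) s1).+1.

(** The indicator of [t <= c_k] splits into those of [t <= B_k] and of [B_k < t <= c_k]; the 0 in
    front of [b] is never counted. *)
Lemma count_leq_pointwise b c t :
    0 < t -> size c = (size b).+1 -> (forall k, nth 0 (0 :: b) k <= nth 0 c k) ->
  count (leq t) c = count (leq t) b
    + count (fun k => nth 0 (0 :: b) k < t <= nth 0 c k) (iota 0 (size c)).
Proof.
move=> t_gt0 sz_c le_bc.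
have <- : count (leq t) (0 :: b) = count (leq t) b by rewrite /= leqNgt t_gt0.
rewrite -[LHS](@count_nth_iota _ (size c)) //.
rewrite -(@count_nth_iota (0 :: b) (size c)) ?sz_c //.
rewrite -[RHS]count_predUI [X in _ + X](_ : _ = 0) ?addn0; last first.
  by apply/eqP; rewrite -leqn0 leqNgt -has_count; apply/hasPn => k _ /=; lia.
by apply: eq_count => k /=; have := le_bc k; move: (nth _ _ _) (nth _ _ _); lia.
Qed.

Lemma strip_one_more b c :
  size c = (size b).+1 -> strip b c -> one_more b c.
Proof.
move=> sz_c [le_bc sep] t t_gt0; rewrite (count_leq_pointwise t_gt0 sz_c le_bc).
rewrite leq_addr -addn1 leq_add2l;
  apply: count_uniq_le1 (iota_uniq _ _) _ => r s _ _.
wlog lt_rs : r s / r < s => [IH|].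
  by case: (ltngtP r s) => [/IH|/IH H pr ps|//] //; rewrite H.
have := sep r s lt_rs; have := le_bc r; have := le_bc s.
move: (nth 0 _ _) (nth 0 _ _) (nth 0 _ _) (nth 0 _ _); lia.
Qed.

Lemma greedy_strip b c :
    size c = (size b).+1 -> (forall k, nth 0 (0 :: b) k <= nth 0 c k) ->
    one_more b c -> greedy b c ->
  strip b c.
Proof.
move=> sz_c le_bc more greedy_bc; split=> // r s lt_rs lt_s.
case: (greedy_bc r s lt_rs) => [|le_sr]; first by right.
left; rewrite leqNgt; apply/negP => lt_r.
(* Take [c_s] as threshold: if [B_r < c_s <= c_r], the intervals []B_r, c_r]] and []B_s, c_s]] both
   contain it, so its count grows by at least 2 from [b] to [c]. *)
have c_gt0: 0 < nth 0 c s by apply: leq_ltn_trans lt_s.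
have lt_sz: s < size c.
  by rewrite ltnNge; apply/negP => ?; rewrite nth_default in c_gt0.
have := more _ c_gt0; rewrite (count_leq_pointwise c_gt0 sz_c le_bc).
set d := count _ (iota _ _); suff: 1 < d by lia.
rewrite /d -size_filter.
apply: (@leq_trans (size [:: r; s])) => //; apply: uniq_leq_size.
  by rewrite /= inE ltn_eqF.
move=> k; rewrite !inE mem_filter mem_iota add0n leq0n => /orP[]/eqP-> /=.
  by rewrite (ltn_trans lt_rs) // le_sr lt_r.
by rewrite lt_s leqnn.
Qed.

Lemma one_more_interlace b c :
  one_more b c -> interlace (sort_decr b) (sort_decr c).
Proof.
by move=> more j; apply/andP; split; apply: leq_nth_sort_decr2 => t /more; lia.
Qed.

Lemma interlace_one_more b c :
  sorted geq b -> sorted geq c -> interlace b c -> one_more b c.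
Proof.
move=> b_sorted c_sorted il t t_gt0; apply/andP; split.
  (* Evaluate at the index [count (leq t) c]: there the entry of [b] would be at least [t], hence
     also that of [c], which is one entry too many. *)
  rewrite leqNgt; apply/negP.
  by rewrite -leq_nth_sorted // => /leq_trans/(_ (proj2 (andP (il _))));
    rewrite leq_nth_sorted // ltnn.
rewrite leqNgt; apply/negP.
by rewrite -leq_nth_sorted // => /leq_trans/(_ (proj1 (andP (il _))));
  rewrite leq_nth_sorted // ltnn.
Qed.

(** * Greedy placement *)

Lemma last_filter_iota (p : pred nat) m :
  let k := last 0 [seq i <- iota 0 m | p i] in
  (forall s, k < s < m -> ~~ p s) /\ (p k && (k < m) \/ k = 0).
Proof.
elim: m => [|m [IHmax IHp]]; first by split=> [s|]; [lia | right].
rewrite -[m.+1]addn1 iotaD filter_cat [iota (0 + m) 1]/= add0n /=; case: ifP => pm.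
  by rewrite last_cat /=; split; [lia | left; rewrite pm addn1 ltnSn].
rewrite cats0; split=> [s|]; last by case: IHp; [left; lia | right].
by case: (ltngtP s m) => [||->]; [move=> *; apply: IHmax; lia | lia | rewrite pm].
Qed.

Definition free (b : seq nat) (row : seq (option nat)) (v k : nat) : bool :=
  (nth None row k == None) && (nth 0 (0 :: b) k <= v).

(* Position 0 is reached only as a fallback, but it may be treated as admissible
   as soon as some position is free, since 0 :: b starts with 0. *)
Lemma placeE b row v :
    (exists2 k, k < size row & free b row v k) ->
  exists k, [/\ k < size row, free b row v k,
    forall s, k < s < size row -> ~~ free b row v s
    & place b row v = set_nth None row k (Some v)].
Proof.
case=> k0 lt_k0 free_k0; rewrite /place.
pose p k := [&& 0 < k, nth None row k == None & nth 0 b k.-1 <= v].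
have pE k : p k = (0 < k) && free b row v k by case: k.
have [] := last_filter_iota p (size row).
move: (last _ _) => k k_max k_adm.
have k_free s : k < s < size row -> ~~ free b row v s.
  by move=> s_bd; have := k_max s s_bd; rewrite pE; case: s s_bd.
exists k; suff [] : k < size row /\ free b row v k by split.
case: k_adm => [/andP[]|k_eq0]; first by rewrite pE => /andP[].
rewrite k_eq0 in k_free *; split; first by apply: leq_ltn_trans lt_k0.
by case: k0 lt_k0 free_k0 => // k0 lt_k0; rewrite (negPf (k_free _ _)).
Qed.

(** Uniqueness of the greedy row, by induction on the values still to be placed: occupied positions
    agree with [c], and [rest] lists the entries of [c] at the unoccupied ones. *)
Lemma foldl_place_greedy b c row rest :
    (forall k, nth 0 (0 :: b) k <= nth 0 c k) -> greedy b c ->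
    size row = size c ->
    (forall k, k < size c ->
      nth None row k = None \/ nth None row k = Some (nth 0 c k)) ->
    perm_eq [seq nth 0 c k | k <- iota 0 (size c) & nth None row k == None] rest ->
    sorted leq rest ->
  foldl (place b) row rest = map Some c.
Proof.
move=> le_bc greedy_bc.
elim: rest row => [|v rest IH] row sz_row row_c c_rest rest_sorted /=.
  apply: (@eq_from_nth _ None) => [|k lt_k]; first by rewrite size_map.
  rewrite sz_row in lt_k; rewrite (nth_map 0) //.
  case: (row_c k lt_k) => // row_k.
  have /size0nil E := etrans (esym (size_map _ _)) (perm_size c_rest).
  have : k \in [seq k <- iota 0 (size c) | nth None row k == None].
    by rewrite mem_filter mem_iota row_k eqxx.
  by rewrite E.
have v_max a : a < size c -> nth None row a = None -> v <= nth 0 c a.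
  move=> lt_a row_a; have : nth 0 c a \in v :: rest.
    rewrite -(perm_mem c_rest); apply: map_f.
    by rewrite mem_filter mem_iota row_a eqxx.
  rewrite inE => /orP[/eqP-> // |].
  move: rest_sorted; rewrite /= path_sortedE; last exact: leq_trans.
  by case/andP=> /allP v_min _ /v_min.
have [r /andP[row_r lt_r] v_eq] : exists2 r,
    (nth None row r == None) && (r < size c) & v = nth 0 c r.
  have : v \in v :: rest by rewrite mem_head.
  rewrite -(perm_mem c_rest) => /mapP[r]; rewrite mem_filter mem_iota => r_in ->.
  by exists r.
have free_r : free b row v r by rewrite /free row_r v_eq le_bc.
have [k [lt_k free_k k_max ->]] : exists k, [/\ k < size row, free b row v k,
    forall s, k < s < size row -> ~~ free b row v s
    & place b row v = set_nth None row k (Some v)].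
  by apply: placeE; exists r; rewrite // sz_row.
have [/eqP row_k le_Bk] := andP free_k.
rewrite sz_row in lt_k k_max.
(* [c_k] is still to be placed, so it is at least the least value [v = c_r]. If [r < k], then
   [B_k <= v] and greediness of [c] leave only [c_k <= v]; and [k < r] contradicts the choice of [k]
   as rightmost. *)
have c_k : nth 0 c k = v.
  apply/eqP; rewrite eqn_leq v_max // andbT.
  case: (ltngtP r k) => [lt_rk|lt_kr|<-]; last by rewrite v_eq.
    by case: (greedy_bc r k lt_rk); rewrite -v_eq // ltnNge le_Bk.
  by have := k_max r; rewrite lt_kr lt_r free_r => /(_ isT).
apply: IH.
- by rewrite size_set_nth sz_row; apply/maxn_idPr.
- move=> a lt_a; rewrite nth_set_nth /=; case: eqP => [->|_].
    by right; rewrite c_k.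
  exact: row_c.
- rewrite -(perm_cons v); apply: perm_trans c_rest; rewrite perm_sym.
  rewrite -[in v :: _]c_k -[nth 0 c k :: _]/(map (nth 0 c) (k :: _)).
  apply: perm_map; set old := [seq k <- _ | _ == _].
  rewrite (_ : [seq k <- _ | _ == _] = rem k old); last first.
    rewrite rem_filter ?filter_uniq ?iota_uniq // /old -filter_predI.
    by apply: eq_filter => a /=; rewrite nth_set_nth /=; case: (a == k).
  by apply: perm_to_rem; rewrite mem_filter row_k eqxx mem_iota.
- exact: path_sorted rest_sorted.
Qed.

Lemma place_row_greedy b c :
    (forall k, nth 0 (0 :: b) k <= nth 0 c k) -> greedy b c ->
  forall r, perm_eq c r -> place_row b r = c.
Proof.
move=> le_bc greedy_bc r c_r; rewrite /place_row (@foldl_place_greedy b c) //.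
- by rewrite -map_comp map_id.
- by rewrite size_nseq (perm_size c_r).
- by move=> k _; left; rewrite nth_nseq if_same.
- rewrite (eq_filter (a2 := predT)) => [|k]; last by rewrite nth_nseq if_same eqxx.
  rewrite filter_predT -/(mkseq (nth 0 c) (size c)) mkseq_nth.
  by rewrite perm_sym perm_sort perm_sym.
- exact: (sort_sorted leq_total).
Qed.

(** Complementary count, as [r] and [0 :: b] have the same length. This is the counting condition
    that keeps the greedy placement from getting stuck. *)
Lemma one_more_count b r v :
    size r = (size b).+1 -> one_more b r ->
  count (geq v) r <= count (geq v) (0 :: b).
Proof.
move=> sz_r /(_ v.+1 isT) /andP[le_br _].
have cntE s : count (geq v) s + count (leq v.+1) s = size s.
  rewrite -(count_predC (geq v) s); congr (_ + _).
  by apply: eq_count => a /=; rewrite ltnNge.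
have := cntE r; have := cntE (0 :: b); rewrite sz_r /=; lia.
Qed.

Lemma sub_in_count (T : eqType) (p q : pred T) s :
  {in s, subpred p q} -> count p s <= count q s.
Proof.
move=> sub_pq; rewrite (@eq_in_count _ p (predI p q)) => [|k /sub_pq] /=.
  by apply: sub_count => k /andP[].
by case: (p k) => // ->.
Qed.

(** Existence of the greedy row. The invariant says that each placed value [v] is admissible where
    it sits, and that every position further right has [B_s > v] or holds a value at most [v]. Later
    steps fill only unoccupied positions and so preserve this. *)
Lemma foldl_place_spec b r row rest :
    size r = (size b).+1 ->
    (forall v, count (geq v) r <= count (geq v) (0 :: b)) ->
    size row = size r ->
    perm_eq (pmap id row ++ rest) r ->
    (forall k v, nth None row k = Some v -> nth 0 (0 :: b) k <= v
       /\ forall s, k < s < size r -> v < nth 0 (0 :: b) s \/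
            exists2 w, nth None row s = Some w & w <= v) ->
    {in pmap id row & rest, forall u v, u <= v} ->
    sorted leq rest ->
  exists c, [/\ foldl (place b) row rest = map Some c, perm_eq c r,
    forall k, nth 0 (0 :: b) k <= nth 0 c k & greedy b c].
Proof.
move=> sz_r count_r.
elim: rest row => [|v rest IH] row sz_row row_r row_ok row_rest rest_sorted /=.
  have row_map : row = map Some (map (odflt 0) row).
    rewrite cats0 in row_r; rewrite -map_comp -[LHS]map_id.
    have := perm_size row_r; rewrite size_pmap -sz_row => /eqP; rewrite -all_count.
    by move=> /allP row_some; apply/eq_in_map => -[a|] // /row_some.
  move: (map _ row) row_map => c row_c; rewrite row_c in row_r row_ok sz_row *.
  rewrite size_map in sz_row; rewrite cats0 (@map_pK _ _ id Some) // in row_r.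
  have le_c k v : k < size r -> nth 0 c k = v -> nth None (map Some c) k = Some v.
    by move=> lt_k <-; rewrite (nth_map 0) ?sz_row.
  exists c; split=> // k.
    case: (ltnP k (size r)) => [/le_c/(_ erefl)/row_ok[]|le_k] //.
    by rewrite [nth 0 (0 :: b) k]nth_default //= -sz_r.
  move=> s lt_ks; case: (ltnP s (size r)) => [lt_s|le_s]; last first.
    by right; rewrite nth_default // sz_row.
  have [] := row_ok k (nth 0 c k) (le_c _ _ (ltn_trans lt_ks lt_s) erefl).
  move=> _ /(_ s); rewrite lt_ks lt_s => /(_ isT)[]; first by left.
  by case=> w; rewrite (le_c _ _ lt_s erefl) => -[->]; right.
have rest_v : forall u, u \in rest -> v <= u.
  move: rest_sorted; rewrite /= path_sortedE; last exact: leq_trans.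
  by case/andP=> /allP.
have row_v u : u \in pmap id row -> u <= v.
  by move=> u_row; apply: row_rest; rewrite ?mem_head.
have [k [lt_k free_k k_max ->]] : exists k, [/\ k < size row, free b row v k,
    forall s, k < s < size row -> ~~ free b row v s
    & place b row v = set_nth None row k (Some v)].
  apply: placeE; case: (boolP (has (free b row v) (iota 0 (size row)))).
    by case/hasP=> k; rewrite mem_iota => lt_k; exists k.
  (* With nothing free, every position [s] with [B_s <= v] is occupied. There are at least as many
     of these as entries of [r] that are at most [v], which include all placed values and [v]
     itself: more than the occupied positions. *)
  move=> /hasPn no_free; suff : size (pmap id row) < size (pmap id row).
    by rewrite ltnn.
  apply: (@leq_trans (count (geq v) r)).
    rewrite -(permP row_r) count_cat /= leqnn addnCA -addn1 addnC leq_add2l.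
    rewrite (eqP (_ : count (geq v) (pmap id row) == size (pmap id row)))
      ?leq_addr //.
    by rewrite -all_count; apply/allP.
  apply: leq_trans (count_r v) _.
  rewrite -(mkseq_nth 0 (0 :: b)) /mkseq count_map size_pmap.
  rewrite -[X in _ <= count _ X](mkseq_nth None row) /mkseq count_map.
  rewrite -[size (0 :: b)]/((size b).+1) -sz_r -sz_row;
    apply: sub_in_count => k /no_free.
  by rewrite /free /= negb_and => /orP[|/negPf->] //; case: (nth None row k).
have [/eqP row_k le_Bk] := andP free_k.
have perm_row' : perm_eq (pmap id (set_nth None row k (Some v))) (v :: pmap id row).
  rewrite set_nthE lt_k -[in X in perm_eq _ X](cat_take_drop k row).
  by rewrite (drop_nth None lt_k) row_k !pmap_cat /= perm_catC /= perm_cons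
    perm_catC.
apply: IH.
- by rewrite size_set_nth sz_row; apply/maxn_idPr; rewrite -sz_row.
- apply: perm_trans row_r; rewrite perm_sym -cat1s perm_catCA.
  by rewrite catA perm_cat2r perm_sym.
- move=> a u; rewrite nth_set_nth /=; case: eqP => [->[<-]|_ row_a].
    split=> // s /andP[lt_ks lt_s]; rewrite nth_set_nth /= gtn_eqF //.
    have := k_max s; rewrite lt_ks sz_row lt_s => /(_ isT).
    rewrite negb_and -ltnNge => /orP[|]; last by left.
    case E: (nth None row s) => [w|] // _; right; exists w => //.
    apply: row_v; rewrite -[row](cat_take_drop s) (drop_nth None) ?sz_row //.
    by rewrite pmap_cat mem_cat /= E mem_head orbT.
  have [le_Ba sep] := row_ok a u row_a; split=> // s /sep[|[w row_s le_wu]].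
    by left.
  right; exists w => //; rewrite nth_set_nth /=; case: eqP => // sk.
  by rewrite sk row_k in row_s.
- move=> u w; rewrite (perm_mem perm_row') inE =>
  /orP[/eqP->|/row_v le_uv] /rest_v //.
  exact: leq_trans.
- exact: path_sorted rest_sorted.
Qed.

Lemma place_row_spec b r :
    size r = (size b).+1 -> one_more b r ->
  perm_eq (place_row b r) r /\ strip b (place_row b r).
Proof.
move=> sz_r more.
have [|||||c [row_c c_r le_bc greedy_bc]] := @foldl_place_spec b r
    (nseq (size r) None) (sort leq r) sz_r (fun v => one_more_count v sz_r more).
- exact: size_nseq.
- rewrite (_ : pmap _ _ = [::]) ?perm_sort //.
  by elim: (size r).
- by move=> k v; rewrite nth_nseq if_same.
- by move=> u v; rewrite (_ : pmap _ _ = [::]) //; elim: (size r).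
- exact: (sort_sorted leq_total).
rewrite /place_row row_c -map_comp map_id; split=> //.
apply: greedy_strip => //; first by rewrite (perm_size c_r).
by move=> t /more; rewrite (permP c_r).
Qed.

(** * Patterns *)

Definition chain (R : seq nat -> seq nat -> Prop) (x : seq (seq nat)) : Prop :=
  forall i, i.+1 < size x -> R (nth [::] x i.+1) (nth [::] x i).

Lemma chain_cons R r x :
  chain R (r :: x) <-> (x <> [::] -> R (head [::] x) r) /\ chain R x.
Proof.
split=> [Rx|[Rr Rx] [|i] /= lt_i].
- by split=> [|i lt_i]; [case: x Rx => // r' x /(_ 0 isT) | apply: (Rx i.+1)].
- by rewrite nth0; apply: Rr => x0; rewrite x0 in lt_i.
- exact: Rx.
Qed.

Lemma triangular_cons n r x :
  triangular n.+1 (r :: x) <-> size r = n.+1 /\ triangular n x.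
Proof.
rewrite /triangular -[n.+1]addn1 iotaD rev_cat /= add1n addn1.
by split=> [[-> ->]|[-> ->]].
Qed.

Lemma triangular_size n x :
  triangular n x -> size x = n /\ forall i, size (nth [::] x i) = n - i.
Proof.
move=> x_tri; have sz_x : size x = n.
  by rewrite -(size_map size) -/(shape x) x_tri size_rev size_iota.
split=> // i; case: (ltnP i n) => [lt_i|le_ni].
  rewrite -(nth_map _ 0) ?sz_x // -/(shape x) x_tri nth_rev ?size_iota //.
  by rewrite nth_iota; lia.
by rewrite nth_default ?sz_x //=; lia.
Qed.

(** The third alternative covers [b = c]. For [b < c], the first amounts to [c <= a] and the second
    to [d < b], the other inequalities following by transitivity. *)
Lemma array_conditionE a b c d : a <= d -> b <= c ->
  array_condition a b c d <-> (b < c -> c <= a \/ d < b).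
Proof.
move=> le_ad le_bc; split=> [[]|]; [lia | lia | lia |].
case: (ltngtP b c) => [lt_bc|lt_cb|->] H; last 1 first.
- by case: (leqP c a) => ?; [apply: Or31 | apply: Or33].
- by case: (H isT) => ?; [apply: Or31; lia | apply: Or32; lia].
- lia.
Qed.

Lemma comp_array_patternP gamma x :
  comp_array_pattern gamma x <->
  [/\ triangular (size gamma) x, head [::] x = gamma & chain strip x].
Proof.
split=> [[x_tri first_row le_x cond]|[x_tri first_row strip_x]];
  have [sz_x sz_row] := triangular_size x_tri.
- split=> //.
    apply: (@eq_from_nth _ 0) => [|i]; first by rewrite -nth0 sz_row subn0.
    rewrite -nth0 sz_row subn0 => lt_i.
    by have /= -> := first_row i.+1 lt_i.
  move=> i; rewrite sz_x => lt_i.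
  have le_row k : nth 0 (0 :: nth [::] x i.+1) k <= nth 0 (nth [::] x i) k.
    case: k => //= k; case: (ltnP k (size gamma - i.+1)) => [lt_k|le_k].
      by apply: (le_x i.+2 k.+1); lia.
    by rewrite nth_default ?sz_row.
  (* [B_s < c_s] makes [c_s] nonzero, so [s] lies inside the row and the bounded condition of the
     pattern applies. *)
  split=> // r s lt_rs lt_s; have lt_s_n: s < size gamma - i.
    by rewrite -sz_row ltnNge; apply/negP => /(nth_default 0) E; rewrite E in lt_s.
  have := cond i.+1 r s; rewrite /entry /= => /(_ _ _ _)/array_conditionE;
    apply=> //; lia.
split=> //.
- by move=> [|i] // /andP[_ lt_i]; rewrite -first_row /entry /= nth0.
- move=> [|[|i]] [|j] // /andP[_ lt_i] _; rewrite /entry /=.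
  by have [] := strip_x i; rewrite ?sz_x // => /(_ j.+1).
- move=> [|i] r s // lt_i lt_rs le_s; have [|le_row sep] := strip_x i.
    by rewrite sz_x; lia.
  by apply/array_conditionE; [apply: le_row|apply: le_row|apply: sep].
Qed.

Lemma GT_patternP lambda y :
  GT_pattern lambda y <->
  [/\ triangular (size lambda) y, head [::] y = lambda & chain interlace y].
Proof.
split=> [[y_tri first_row il_y]|[y_tri first_row il_y]];
  have [sz_y sz_row] := triangular_size y_tri.
- split=> //.
    apply: (@eq_from_nth _ 0) => [|i]; first by rewrite -nth0 sz_row subn0.
    rewrite -nth0 sz_row subn0 => lt_i.
    by have /= -> := first_row i.+1 lt_i.
  move=> i; rewrite sz_y => lt_i j;
    case: (ltnP j (size lambda - i.+1)) => [lt_j|le_j].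
    by apply: (il_y i.+1 j.+1); lia.
  rewrite [nth 0 _ j.+1]nth_default ?[nth 0 (nth _ _ i.+1) j]nth_default ?sz_row
    //; lia.
split=> //.
- by move=> [|i] // /andP[_ lt_i]; rewrite -first_row /entry /= nth0.
- move=> [|i] [|j] // lt_i _; apply: (il_y i); rewrite sz_y; lia.
Qed.

(** * Row sorting and greedy placement as mutually inverse maps *)

Lemma nth_map_sort_decr x i :
  nth [::] (map sort_decr x) i = sort_decr (nth [::] x i).
Proof.
case: (ltnP i (size x)) => [lt_i|le_i]; first exact: nth_map.
by rewrite !nth_default ?size_map.
Qed.

Lemma nth_Theta x i : nth [::] (Theta x) i = sort_decr (nth [::] x i).
Proof. exact: nth_map_sort_decr. Qed.

Lemma shape_map_sort_decr x : shape (map sort_decr x) = shape x.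
Proof. by rewrite /shape -map_comp; apply: eq_map => r /=; rewrite size_sort. Qed.

Lemma triangular_Theta n x : triangular n x -> triangular n (Theta x).
Proof. by rewrite /triangular shape_map_sort_decr. Qed.

Lemma Theta_GT gamma x :
  comp_array_pattern gamma x -> GT_pattern (sort_decr gamma) (Theta x).
Proof.
case/comp_array_patternP=> x_tri head_x strip_x; apply/GT_patternP.
split; first by rewrite size_sort; apply: triangular_Theta.
  by rewrite -nth0 nth_Theta nth0 head_x.
move=> i; rewrite size_map !nth_Theta => lt_i; apply: one_more_interlace.
have [sz_x sz_row] := triangular_size x_tri.
by apply: strip_one_more; [rewrite !sz_row; lia | apply: strip_x].
Qed.

Lemma Theta_inv_cons r y : y <> [::] ->
  Theta_inv (r :: y) = place_row (head [::] (Theta_inv y)) r :: Theta_inv y.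
Proof. by case: y. Qed.

(** Induction from the bottom row upwards: once the row below is recovered, the next row is greedy
    over it, hence is what the placement makes of its multiset. *)
Lemma ThetaK n x : triangular n x -> chain strip x -> Theta_inv (Theta x) = x.
Proof.
elim: x n => [|r [|r' x] IH] [|n] // /triangular_cons[sz_r x_tri].
  have [sz0 _] := triangular_size x_tri; rewrite -sz0 in sz_r.
  by case: r sz_r => [|a [|]].
case/chain_cons=> /(_ ltac:(done)) strip_r /(IH n x_tri) {}IH.
rewrite -[Theta (r :: _)]/(sort_decr r :: Theta (r' :: x)) Theta_inv_cons // IH.
congr (_ :: _); apply: place_row_greedy; first by case: strip_r.
  exact: strip_greedy.
by rewrite perm_sym perm_sort.
Qed.

Lemma Theta_inv_spec n y :
    triangular n y -> (forall i, sorted geq (nth [::] y i)) -> chain interlace y ->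
  [/\ triangular n (Theta_inv y), chain strip (Theta_inv y)
    & Theta (Theta_inv y) = y].
Proof.
elim: y n => [|r y IH] [|n] // /triangular_cons[sz_r y_tri] y_sorted.
case/chain_cons=> il_r il_y.
have [x_tri strip_x ThetaK_x] := IH n y_tri (fun i => y_sorted i.+1) il_y.
case: (eqVneq y [::]) => [y0|/eqP y_n0].
  rewrite y0 in y_tri *; split=> //; first exact/triangular_cons.
  by rewrite /Theta /= (sort_decr_id (y_sorted 0)).
rewrite Theta_inv_cons //; set x := Theta_inv y in x_tri strip_x ThetaK_x *.
have head_x : sort_decr (head [::] x) = head [::] y.
  by rewrite -ThetaK_x -!nth0 nth_Theta.
have [||c_r strip_c] := @place_row_spec (head [::] x) r.
- by rewrite -nth0 (proj2 (triangular_size x_tri)) subn0.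
(* [one_more] involves only counts, so it passes from the head of [y] to the head of [x], which is a
   rearrangement of it. *)
- have := interlace_one_more (y_sorted 1) (y_sorted 0) _.
  rewrite /= nth0 => /(_ (il_r y_n0)) more t /more.
  by rewrite -head_x /sort_decr (permP (permEl (perm_sort _ _))).
split.
- by apply/triangular_cons; rewrite (perm_size c_r).
- exact/chain_cons.
- rewrite /Theta map_cons -/(Theta x) ThetaK_x; congr (_ :: _).
  by rewrite (perm_sort_decr c_r) (sort_decr_id (y_sorted 0)).
Qed.

(** Two neighbours in a row have an entry of the next row between them; the last row has at most one
    entry. *)
Lemma GT_rows_sorted lambda y i : GT_pattern lambda y -> sorted geq (nth [::] y i).
Proof.
case/GT_patternP=> y_tri head_y il_y; have [sz_y sz_row] := triangular_size y_tri.
case: (ltnP i.+1 (size y)) => [/il_y il|le_i].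
  by apply: sorted_geq_nth => j; case/andP: (il j) => /leq_trans; apply.
have := sz_row i; rewrite -sz_y; case: (nth _ _ _) => [|a [|b r]] //=; lia.
Qed.

Lemma Theta_bijection gamma :
  bijection_with_inverse (comp_array_pattern_sorting_to (sort_decr gamma))
    (GT_pattern (sort_decr gamma)) Theta Theta_inv.
Proof.
have inv y : GT_pattern (sort_decr gamma) y -> _ := fun GT_y =>
  Theta_inv_spec (let: And3 y_tri _ _ := proj1 (GT_patternP _ _) GT_y in y_tri)
    (fun i => GT_rows_sorted i GT_y)
    (let: And3 _ _ il_y := proj1 (GT_patternP _ _) GT_y in il_y).
split=> [x [delta <-]|y GT_y|x [delta _]|y /inv[]//].
- exact: Theta_GT.
- have [x_tri strip_x ThetaK_y] := inv y GT_y.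
  have [y_tri head_y _] := proj1 (GT_patternP _ _) GT_y.
  exists (head [::] (Theta_inv y));
    first by rewrite -head_y -nth0 -nth_Theta ThetaK_y.
  apply/comp_array_patternP; split=> //.
  by rewrite -nth0 (proj2 (triangular_size x_tri)) subn0.
- by case/comp_array_patternP=> x_tri _; exact: ThetaK x_tri.
Qed.

(** * Columns and transposition *)

Lemma nth_shape (T : seq (seq nat)) i : nth 0 (shape T) i = size (nth [::] T i).
Proof.
by case: (ltnP i (size T)) => ?; [exact: nth_map | rewrite !nth_default ?size_map].
Qed.

Lemma max_size (T : seq (seq nat)) : \max_(r <- T) size r =
  nth 0 (sort_decr (shape T)) 0.
Proof.
apply: eq_of_leq => t t_gt0; rewrite leq_nth_sort_decr // -has_count.
elim: T => [|r T IHT]; first by rewrite big_nil leqNgt t_gt0.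
by rewrite big_cons leq_max IHT.
Qed.

Lemma size_column T j : size (column T j) = count (leq j) (shape T).
Proof. by rewrite size_map size_filter count_map. Qed.

Lemma size_transpose T : size (transpose T) = nth 0 (sort_decr (shape T)) 0.
Proof. by rewrite size_map size_iota max_size. Qed.

Lemma nth_transpose T j : nth [::] (transpose T) j = column T j.+1.
Proof.
case: (ltnP j (size (transpose T))) => [lt_j|le_j].
  rewrite (nth_map 0) ?nth_iota //; by rewrite size_map size_iota in lt_j *.
rewrite nth_default //; apply/esym/size0nil/eqP; rewrite size_column -leqn0.
by rewrite leqNgt -leq_nth_sort_decr // -size_transpose -leqNgt.
Qed.

Lemma nth_shape_transpose T j : nth 0 (shape (transpose T)) j =
  count (leq j.+1) (shape T).
Proof. by rewrite nth_shape nth_transpose size_column. Qed.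

Lemma sorted_shape_transpose T : sorted geq (shape (transpose T)).
Proof.
apply: sorted_geq_nth => j; rewrite !nth_shape_transpose.
by apply: sub_count => m /=; apply: ltnW.
Qed.

(** The column lengths form the conjugate partition, and conjugating once more returns the row
    lengths in decreasing order. *)
Lemma count_shape_transpose T i :
  count (leq i.+1) (shape (transpose T)) = nth 0 (sort_decr (shape T)) i.
Proof.
rewrite /transpose /shape -map_comp count_map.
rewrite (eq_in_count (a2 := fun j => j <= nth 0 (sort_decr (shape T)) i));
  last first.
  move=> j; rewrite mem_iota => /andP[j_gt0 _] /=.
  by rewrite size_column leq_nth_sort_decr.
rewrite count_iota_leq max_size; apply/minn_idPl.
by apply: leq_nth_sort_decr2 => t _; apply: leq_ltn_trans.
Qed.

Lemma filter_sorted_take (A : Type) (f : A -> nat) s j :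
    sorted geq (map f s) ->
  [seq r <- s | j <= f r] = take (count (leq j) (map f s)) s.
Proof.
elim: s => [|r s IHs] //= rs_sorted.
rewrite IHs ?(path_sorted rs_sorted) //; case: (leqP j (f r)) => //= lt_r.
suff -> : count (leq j) (map f s) = 0 by rewrite take0.
apply/eqP; rewrite -leqn0 leqNgt -has_count; apply/hasPn => m /=.
move: rs_sorted; rewrite path_sortedE; last exact: (rev_trans leq_trans).
by case/andP=> /allP s_min _ /s_min /= le_m; rewrite -ltnNge (leq_ltn_trans le_m).
Qed.

(** When the row lengths weakly decrease, the rows reaching a given column form a prefix, so no row
    is skipped before row [i]. *)
Lemma nth_column T i j :
  sorted geq (shape T) -> nth 0 (column T j.+1) i = nth 0 (nth [::] T i) j.
Proof.
move=> T_sorted; case: (ltnP j (size (nth [::] T i))) => [lt_j|le_j].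
  rewrite -nth_shape leq_nth_sorted // in lt_j.
  rewrite /column filter_sorted_take // (nth_map [::]) ?nth_take //.
  by rewrite size_takel // -(size_map size) count_size.
rewrite [RHS]nth_default // nth_default // size_column leqNgt -leq_nth_sorted //.
by rewrite nth_shape -leqNgt.
Qed.

Lemma transposeK T :
  sorted geq (shape T) -> all (ltn 0) (shape T) -> transpose (transpose T) = T.
Proof.
move=> T_sorted T_gt0; apply: (@eq_from_nth _ [::]) => [|i _].
  rewrite size_transpose (sort_decr_id (sorted_shape_transpose T)).
  by rewrite nth_shape_transpose -(size_map size); apply/eqP; rewrite -all_count.
have sz_i : size (nth [::] (transpose (transpose T)) i) = size (nth [::] T i).
  rewrite nth_transpose size_column count_shape_transpose.
  by rewrite sort_decr_id // nth_shape.
apply: (@eq_from_nth _ 0) => // j _; rewrite nth_transpose nth_column //.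
  by rewrite nth_transpose nth_column.
exact: sorted_shape_transpose.
Qed.

Lemma all_transpose p T : all (all p) T -> all (all p) (transpose T).
Proof.
move=> /allP T_p; apply/allP => c /mapP[[|j]]; rewrite mem_iota // => _ ->.
apply/allP => m /mapP[r]; rewrite mem_filter => /andP[lt_j /T_p/allP r_p] ->.
by apply: r_p; apply: mem_nth.
Qed.

Lemma count_column T t j :
  0 < t -> count (leq t) (column T j.+1) = count (fun r => t <= nth 0 r j) T.
Proof.
move=> t_gt0; rewrite count_map count_filter; apply: eq_count => r /=.
by case: (ltnP j (size r)) => [|le_r];
  rewrite ?andbT // nth_default // andbF leqNgt t_gt0.
Qed.

(** * Filling nested diagrams *)

Definition nested (n : nat) (D : nat -> nat -> nat) : Prop :=
  (forall i r, 0 < i -> D i.+1 r <= D i r) /\ forall i r, n < i -> D i r = 0.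

Definition fill_row (n : nat) (D : nat -> nat -> nat) (r : nat) : seq nat :=
  flatten [seq nseq (D i r - D i.+1 r) i | i <- rev (iota 1 n)].

Section NestedDiagrams.

Variables (n : nat) (D : nat -> nat -> nat).
Hypothesis nested_D : nested n D.

(** Labels weakly decrease along the row and the block lengths telescope, so the labels [>= t]
    occupy the first [D t r] boxes. *)
Lemma fill_row_spec r :
  size (fill_row n D r) = D 1 r /\
  forall t j, 0 < t -> (t <= nth 0 (fill_row n D r) j) = (j < D t r).
Proof.
case: nested_D => D_decr D0; rewrite /fill_row.
(* Restrict to the labels from [a] to [n], so that each induction step appends the smallest label;
   the base is [a = n.+1], where [D] vanishes. *)
suff: forall a m, 0 < a -> a + m = n.+1 ->
    size (flatten [seq nseq (D i r - D i.+1 r) i | i <- rev (iota a m)]) = D a r /\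
    forall t j, a <= t ->
      (t <= nth 0 (flatten [seq nseq (D i r - D i.+1 r) i | i <- rev (iota a m)]) j)
        = (j < D t r).
  by apply.
move=> a m; elim: m a => [|m IHm] a a_gt0 am_n.
  rewrite addn0 in am_n; split=> [|t j le_at]; first by rewrite D0 ?am_n.
  by rewrite nth_nil D0 -?am_n // leqNgt (leq_trans a_gt0).
rewrite -[m.+1]add1n iotaD rev_cat map_cat flatten_cat addn1.
have [//||sz_row nth_row] := IHm a.+1; first by rewrite addSnnS.
rewrite size_cat sz_row /= cats0 size_nseq subnKC ?D_decr //; split=> // t j le_at.
rewrite nth_cat sz_row; case: ltnP => [lt_j|le_j]; last first.
  rewrite nth_nseq ltn_sub2rE //.
  case: (ltngtP a t) le_at => // [lt_at|<-] _; last by case: ifP; lia.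
  rewrite -(nth_row t j lt_at) [nth 0 (flatten _) j]nth_default ?sz_row //.
  by case: ifP; lia.
case: (ltngtP a t) le_at => // [lt_at|<-] _; first exact: nth_row.
by rewrite (leq_trans lt_j (D_decr a r a_gt0)) ltnW // nth_row.
Qed.

Lemma size_fill_row r : size (fill_row n D r) = D 1 r.
Proof. by case: (fill_row_spec r). Qed.

Lemma leq_nth_fill_row t r j : 0 < t ->
  (t <= nth 0 (fill_row n D r) j) = (j < D t r).
Proof. by case: (fill_row_spec r) => _; apply. Qed.

Lemma nested_le1 t r : 0 < t -> D t r <= D 1 r.
Proof.
case: nested_D => D_decr _; elim: t => [|[|t] IHt] // _.
by apply: leq_trans (IHt _); first apply: D_decr.
Qed.

Lemma fillE : fill n D = [seq fill_row n D r | r <- iota 1 n & 0 < D 1 r].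
Proof.
rewrite /fill filter_map; congr map; apply: eq_filter => r /=.
by rewrite -size_fill_row lt0n size_eq0.
Qed.

Lemma shape_fill : shape (fill n D) = [seq D 1 r | r <- iota 1 n & 0 < D 1 r].
Proof. by rewrite fillE /shape -map_comp; apply: eq_map => r /=;
  rewrite size_fill_row. Qed.

Lemma fill_pos : all (all (ltn 0)) (fill n D).
Proof.
apply/allP => s; rewrite fillE => /mapP[r _ {s}->]; apply/(all_nthP 0) => j.
by rewrite size_fill_row => lt_j /=; rewrite leq_nth_fill_row.
Qed.

Lemma fill_rows_sorted : all (sorted geq) (fill n D).
Proof.
apply/allP => s; rewrite fillE => /mapP[r _ {s}->]; apply: sorted_geq_nth => j.
case E: (nth 0 _ j.+1) => [//|t]; rewrite leq_nth_fill_row // ltnW //.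
by rewrite -leq_nth_fill_row // E.
Qed.

(** Rows deleted as empty contribute nothing, because [D t r <= D 1 r]. The right-hand side depends
    only on the multiset of the lengths [D t r], which is what sorting preserves. *)
Lemma count_column_fill t j : 0 < t ->
  count (leq t) (column (fill n D) j.+1) = count (fun r => j < D t r) (iota 1 n).
Proof.
move=> t_gt0; rewrite count_column // fillE count_map count_filter.
apply: eq_count => r /=; rewrite leq_nth_fill_row //.
apply: andb_idr => lt_j; apply: leq_trans (nested_le1 r t_gt0).
exact: leq_ltn_trans lt_j.
Qed.

End NestedDiagrams.

(** * The fillings [phi] and [psi] of patterns *)

Lemma leq_nth_sorted2 s i j : sorted geq s -> i <= j -> nth 0 s j <= nth 0 s i.
Proof.
move=> s_sorted le_ij; rewrite -(sort_decr_id s_sorted).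
by apply: leq_nth_sort_decr2 => t _; apply: leq_ltn_trans.
Qed.

Lemma GT_interlace lambda y t :
  GT_pattern lambda y -> interlace (nth [::] y t.+1) (nth [::] y t).
Proof.
case/GT_patternP=> y_tri _ il_y; have [sz_y sz_row] := triangular_size y_tri.
case: (ltnP t.+1 (size y)) => [/il_y//|le_t j].
by rewrite nth_default ?sz_row ?[nth [::] y _.+1]nth_default ?nth_nil //; lia.
Qed.

Lemma comp_array_strip gamma x t :
  comp_array_pattern gamma x -> strip (nth [::] x t.+1) (nth [::] x t).
Proof.
case/comp_array_patternP=> x_tri _ strip_x;
  have [sz_x sz_row] := triangular_size x_tri.
case: (ltnP t.+1 (size x)) => [/strip_x//|le_t].
rewrite [nth [::] x _.+1]nth_default //; split=> [[|k]|r [|s]] //=.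
  by rewrite nth_nil.
by move=> _; rewrite [nth 0 (nth _ _ _) _]nth_default ?sz_row ?ltn0 //; lia.
Qed.

Lemma entryS x t j : entry x t.+1 j = nth 0 (0 :: nth [::] x t) j.
Proof. by []. Qed.

Lemma entry_oversize x i j : size x < i -> entry x i j = 0.
Proof. by case: i => // i le_i; rewrite entryS [nth [::] x i]nth_default //;
  case: j => [|j] //=; rewrite nth_nil. Qed.

Lemma positive_partsE s :
  positive_parts s =
  [seq nth 0 (0 :: s) r | r <- iota 1 (size s) & 0 < nth 0 (0 :: s) r].
Proof.
by rewrite /positive_parts -{1}(mkseq_nth 0 s) /mkseq (iotaDl 1) !filter_map
  -map_comp.
Qed.

Lemma support_setE s :
  support_set s = [seq r <- iota 1 (size s) | 0 < nth 0 (0 :: s) r].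
Proof. by apply: eq_in_filter => -[|r]; rewrite ?mem_iota. Qed.

Lemma positive_parts_sort_decr s :
  positive_parts (sort_decr s) = sort_decr (positive_parts s).
Proof. by apply: filter_sort => [m k|];
  [apply: leq_total|apply: (rev_trans leq_trans)]. Qed.

Lemma nested_entry lambda y : GT_pattern lambda y -> nested (size y) (entry y).
Proof.
move=> GT_y; split=> [[|t] [|j] // _|i r]; last exact: entry_oversize.
by case/andP: (GT_interlace t GT_y j).
Qed.

Definition psi_diagram (x : seq (seq nat)) (i r : nat) : nat :=
  entry x i (r.+1 - i).

(** Lower left alignment moves the rows of the next diagram down by one, so containment is the
    pointwise inequality between [0 :: b] and [c] in [strip]. *)
Lemma nested_psi_diagram gamma x :
  comp_array_pattern gamma x -> nested (size x) (psi_diagram x).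
Proof.
move=> cap_x; split=> [[|t] r // _|i r]; last exact: entry_oversize.
rewrite /psi_diagram !entryS subSS; case: (leqP t.+1 r) => [lt_tr|le_rt].
  by rewrite subSn // -subSS subSS;
    case: (comp_array_strip t cap_x) => /(_ (r - t.+1)).
by rewrite (eqP (_ : r - t.+1 == 0)) // subn_eq0 ltnW.
Qed.

Lemma phi_count lambda y t j : GT_pattern lambda y -> 0 < t ->
  count (leq t) (column (phi y) j.+1) = count (leq j.+1) (nth [::] y t.-1).
Proof.
move=> GT_y t_gt0; rewrite (count_column_fill (nested_entry GT_y)) //.
case: t t_gt0 => // t _.
have [/triangular_size[sz_y sz_row] _ _] := proj1 (GT_patternP _ _) GT_y.
rewrite (iotaDl 1) count_map -(@count_nth_iota _ (size y)) //.
by rewrite sz_row sz_y leq_subr.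
Qed.

Lemma psi_count gamma x t j : comp_array_pattern gamma x -> 0 < t ->
  count (leq t) (column (psi x) j.+1) = count (leq j.+1) (nth [::] x t.-1).
Proof.
move=> cap_x t_gt0; rewrite (count_column_fill (nested_psi_diagram cap_x)) //.
case: t t_gt0 => // t _.
have [/triangular_size[sz_x sz_row] _ _] := proj1 (comp_array_patternP _ _) cap_x.
rewrite /psi_diagram (iotaDl 1) count_map /=.
rewrite (eq_count (a2 := fun k => j < nth 0 (0 :: nth [::] x t) (k.+1 - t)));
  last first.
  by move=> k /=; rewrite entryS subSS.
case: (leqP (size x) t) => [le_t|lt_t].
  rewrite nth_default //=; apply/eqP; rewrite -leqn0 leqNgt -has_count.
  by apply/hasPn => k _; case: (_ - _) => // m; rewrite /= nth_nil.
(* The first [t] rows of the frame lie above the diagram and contribute nothing; the others run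
   through the entries of the pattern row. *)
rewrite -(subnKC (ltnW lt_t)) iotaD count_cat add0n -[in RHS](@count_nth_iota _
  (size x - t)) ?sz_row ?sz_x //.
rewrite (eqP (_ : count _ (iota 0 t) == 0)); last first.
  rewrite -leqn0 leqNgt -has_count; apply/hasPn => k.
  by rewrite mem_iota => /andP[_ lt_k]; rewrite (eqP (_ : k.+1 - t == 0)) ?subn_eq0.
rewrite add0n -[t in iota t _]addn0 iotaDl count_map; apply: eq_count => k /=.
by rewrite -addnS addKn.
Qed.

Lemma shape_phi lambda y : GT_pattern lambda y ->
  shape (phi y) = positive_parts lambda.
Proof.
move=> GT_y; rewrite (shape_fill (nested_entry GT_y)) positive_partsE.
have [/triangular_size[-> _] <- _] := proj1 (GT_patternP _ _) GT_y.
by rewrite -nth0.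
Qed.

Lemma psiE gamma x : comp_array_pattern gamma x ->
  psi x = [seq fill_row (size gamma) (psi_diagram x) r | r <- support_set gamma].
Proof.
move=> cap_x; have [/triangular_size[sz_x _] head_x _] :=
  proj1 (comp_array_patternP _ _) cap_x.
rewrite -[psi x]/(fill (size x) (psi_diagram x)) (fillE (nested_psi_diagram cap_x)).
rewrite sz_x support_setE; congr map; apply: eq_filter => r.
by rewrite /psi_diagram entryS subSS subn0 nth0 head_x.
Qed.

Lemma shape_psi gamma x :
  comp_array_pattern gamma x -> shape (psi x) = positive_parts gamma.
Proof.
move=> cap_x; have [/triangular_size[sz_x _] head_x _] :=
  proj1 (comp_array_patternP _ _) cap_x.
have psi_diagram1 r : psi_diagram x 1 r = nth 0 (0 :: gamma) r.
  by rewrite /psi_diagram entryS subSS subn0 nth0 head_x.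
rewrite (shape_fill (nested_psi_diagram cap_x)) positive_partsE sz_x.
by rewrite (eq_map psi_diagram1); congr map; apply: eq_filter => r;
  rewrite psi_diagram1.
Qed.

Lemma sorted_gtn_geq s : sorted gtn s -> sorted geq s.
Proof. by apply: sub_sorted => m k /ltnW. Qed.

Lemma phi_reverse_tableau lambda y :
  GT_pattern lambda y -> reverse_tableau lambda (phi y).
Proof.
move=> GT_y; have nested_y := nested_entry GT_y.
split; [exact: shape_phi GT_y|exact: fill_pos|exact: fill_rows_sorted|].
have shape_sorted : sorted geq (shape (phi y)).
  rewrite (shape_phi GT_y); apply: sorted_filter;
    first exact: (rev_trans leq_trans).
  by have [_ <- _] := proj1 (GT_patternP _ _) GT_y; rewrite -nth0;
    exact: GT_rows_sorted GT_y.
apply/(all_nthP [::]) => j _; rewrite nth_transpose; apply/(sortedP 0) => i.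
rewrite size_column -leq_nth_sorted // nth_shape => lt_j.
rewrite !nth_column // /=; move: lt_j;
  rewrite -[phi y]/(fill _ (entry y)) (fillE nested_y).
set K := [seq r <- _ | _]; case: (ltnP i.+1 (size K)) => [lt_i|le_i]; last first.
  by rewrite nth_default ?size_map.
have K_sorted : sorted ltn K by apply: sorted_filter (iota_ltn_sorted _ _);
  exact: ltn_trans.
have lt_K : nth 0 K i < nth 0 K i.+1 by apply: (elimT (sortedP 0) K_sorted).
have K_gt0 : 0 < nth 0 K i.
  by have := mem_nth 0 (ltnW lt_i); rewrite mem_filter mem_iota => /and3P[].
rewrite !(nth_map 0) // ?(ltnW lt_i) // size_fill_row // => lt_j.
(* For the lower entry [t], its row has more than [j] boxes in the [t]-th diagram. By interlacing,
   any higher row is at least that long in the next diagram, so the upper entry is at least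
   [t.+1]. *)
set t := nth 0 (fill_row _ _ (nth 0 K i.+1)) j.
have t_gt0 : 0 < t by rewrite leq_nth_fill_row.
rewrite leq_nth_fill_row // (leq_trans (_ : j < entry y t (nth 0 K i.+1))) //.
  by rewrite -(leq_nth_fill_row nested_y).
clearbody t; case: t t_gt0 => // t _.
case: (nth 0 K i) (nth 0 K i.+1) lt_K K_gt0 => [|a] [|b] // lt_ab _;
  rewrite !entryS /=.
apply: leq_trans (@leq_nth_sorted2 _ a.+1 b (GT_rows_sorted t GT_y) lt_ab) _.
by case/andP: (GT_interlace t GT_y a).
Qed.

Lemma psi_comp_tableau gamma x :
  comp_array_pattern gamma x -> comp_tableau_first_column gamma (psi x).
Proof.
move=> cap_x; have nested_x := nested_psi_diagram cap_x.
have [x_tri head_x _] := proj1 (comp_array_patternP _ _) cap_x.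
have [sz_x sz_row] := triangular_size x_tri.
have psiE := psiE cap_x; rewrite -sz_x in psiE.
have strip_x t := comp_array_strip t cap_x.
have S_sorted : sorted ltn (support_set gamma).
  by apply: sorted_filter (iota_ltn_sorted _ _); exact: ltn_trans.
have S_gt0 r : r \in support_set gamma -> 0 < r /\ 0 < psi_diagram x 1 r.
  rewrite support_setE mem_filter mem_iota => /and3P[gamma_r r_gt0 _]; split=> //.
  by rewrite /psi_diagram entryS subSS subn0 nth0 head_x.
have first_column r : r \in support_set gamma ->
  nth 0 (fill_row (size x) (psi_diagram x) r) 0 = r.
  case/S_gt0 => r_gt0 D_gt0; apply: eq_of_leq => -[//|t] _;
    rewrite leq_nth_fill_row //.
  elim: t => [|t IHt]; first by rewrite D_gt0 r_gt0.
  rewrite /psi_diagram !entryS !subSS in IHt *; case: (leqP r t.+1) => [le_r|lt_r].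
    by rewrite (eqP (_ : r - t.+1 == 0)) // subn_eq0.
  rewrite (ltnW lt_r) -[r in r - t](subnK (ltnW lt_r)) in IHt.
  have : 0 < r - t.+1 by rewrite subn_gt0.
  rewrite -addSnnS addnK /= in IHt; move: (r - t.+1) IHt => s c_s s_gt0.
  (* Separation against position 0, where [B_0 = 0]: if [B_s] were 0, then [c_s <= 0] or [c_0 < 0],
     both impossible. So row [r] keeps its first box up to the [r]-th diagram. *)
  have [_ /(_ 0 s s_gt0)] := strip_x t; rewrite lt0n; case: eqP => //= ->.
  by rewrite c_s => /(_ isT)[]; lia.
have column1 : column (psi x) 1 = support_set gamma.
  rewrite psiE /column filter_map -map_comp (eq_in_filter (a2 := predT));
    last first.
    by move=> r /S_gt0[_]; rewrite /= size_fill_row.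
  by rewrite filter_predT -[RHS]map_id; apply/eq_in_map.
split; last by move=> r; rewrite column1.
split; [by split; [exact: shape_psi cap_x|exact: fill_pos]|by rewrite
  column1|exact: fill_rows_sorted|].
move=> [//|i1] [//|i2] [//|[//|j]] _ /ltnSE lt_i _ _.
rewrite !entryS /= psiE => /eqP; rewrite -lt0n.
case: (ltnP i2 (size (support_set gamma))) => [lt_i2|le_i2]; last first.
  by rewrite [nth [::] _ i2]nth_default ?size_map // nth_nil.
have lt_i1 : i1 < size (support_set gamma) := ltn_trans lt_i lt_i2.
rewrite !(nth_map 0) //; set r1 := nth 0 _ i1; set r2 := nth 0 _ i2.
have lt_r : r1 < r2 by apply: (sorted_ltn_nth ltn_trans 0 S_sorted).
set t := nth 0 (fill_row _ _ r2) j.+1 => t_gt0;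
  rewrite -ltnS ltnNge leq_nth_fill_row //.
rewrite -leqNgt => le_D1; rewrite ltnNge leq_nth_fill_row // -leqNgt.
have lt_D2 : j.+1 < psi_diagram x t r2 by rewrite -(leq_nth_fill_row nested_x).
have le_D2 : psi_diagram x t.+1 r2 <= j.+1 by rewrite leqNgt -(leq_nth_fill_row
  nested_x) // ltnn.
clearbody t; case: t t_gt0 le_D1 lt_D2 le_D2 => // t _;
  rewrite /psi_diagram !entryS !subSS.
case: (leqP r1 t) => [le_r|lt_t];
  first by rewrite (eqP (_ : r1 - t == 0)) // subn_eq0.
rewrite (subnS r1) (subnS r2) -[r1 - t]prednK ?subn_gt0 //.
rewrite -[r2 - t]prednK ?subn_gt0 ?(ltn_trans lt_t) //=.
(* With [r], [s] the positions of the rows [r1], [r2] in the pattern, [B_s <= j.+1 < c_s] because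
   the entry of row [r2] is exactly [t.+1]. Also [B_r <= j.+1], which excludes [c_s <= B_r]; hence
   [c_r < B_s <= j.+1], as required. *)
move=> le_a lt_b le_b; have [_ /(_ (r1 - t).-1 (r2 - t).-1)] := strip_x t.
by case=> [||le_ba|lt_ab]; lia.
Qed.

(** * Sorting the columns of a tableau *)

Lemma shape_transpose_pos T : all (ltn 0) (shape (transpose T)).
Proof.
apply/(all_nthP 0) => j; rewrite size_map nth_shape_transpose size_transpose.
by rewrite leq_nth_sort_decr.
Qed.

Lemma shape_theta U : all (ltn 0) (shape U) ->
  shape (theta U) = sort_decr (shape U).
Proof.
move=> U_gt0; apply: (@eq_from_nth _ 0) => [|i _]; last first.
  by rewrite nth_shape_transpose shape_map_sort_decr count_shape_transpose.
rewrite size_map size_transpose shape_map_sort_decr.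
rewrite (sort_decr_id (sorted_shape_transpose U)) nth_shape_transpose size_sort.
by apply/eqP; rewrite -all_count.
Qed.

Lemma transpose_theta U : transpose (theta U) = map sort_decr (transpose U).
Proof.
by apply: transposeK; rewrite shape_map_sort_decr ?sorted_shape_transpose
  ?shape_transpose_pos.
Qed.

(** From one column to the next, the number of entries [>= t] can only drop, and these counts
    determine the sorted columns. *)
Lemma theta_rows_sorted U : all (sorted geq) U -> all (sorted geq) (theta U).
Proof.
move=> /allP U_sorted; apply/(all_nthP [::]) => i _; rewrite nth_transpose.
apply: sorted_geq_nth => j.
rewrite !nth_column ?shape_map_sort_decr ?sorted_shape_transpose //.
rewrite !nth_map_sort_decr !nth_transpose; apply: leq_nth_sort_decr2 => t t_gt0.
move=> /leq_trans; apply; rewrite !count_column //; apply: sub_in_count => r r_U /=.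
by move=> /leq_trans; apply; apply: nth_sorted_geq (U_sorted r r_U).
Qed.

(** Beyond the first column, two equal entries would, by the third tableau condition, exceed the
    left neighbour of the upper one, although its row weakly decreases. *)
Lemma comp_tableau_column_uniq alpha U j :
  comp_tableau alpha U -> uniq (column U j.+1).
Proof.
case=> [[shape_U U_gt0] column1 /allP U_sorted sep].
case: j => [|j]; first by apply: sorted_uniq column1;
  [exact: ltn_trans|exact: ltnn].
rewrite /column -[U](mkseq_nth [::]) /mkseq filter_map -map_comp.
rewrite map_inj_in_uniq ?filter_uniq ?iota_uniq // => i1 i2.
rewrite !mem_filter !mem_iota /= => /andP[lt_j1 lt_i1] /andP[lt_j2 lt_i2].
wlog lt_i : i1 i2 lt_j1 lt_i1 lt_j2 lt_i2 / i1 < i2 => [IH eq_i|eq_i].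
  by case: (ltngtP i1 i2) => // lt_i; [apply: IH|apply/esym/IH].
suff: nth 0 (nth [::] U i1) j < nth 0 (nth [::] U i1) j.+1.
  by rewrite ltnNge nth_sorted_geq // U_sorted // mem_nth.
rewrite eq_i; apply: (sep i1.+1 i2.+1 j.+2) => //.
- by rewrite -shape_U size_map.
- rewrite /= -shape_U (leq_trans lt_j2) // -nth_shape.
  by apply: (leq_bigmax_seq (nth 0 (shape U) i2)) => //; rewrite mem_nth ?size_map.
- apply/eqP; rewrite -lt0n.
  by have /(all_nthP 0)/(_ _ lt_j2) := allP U_gt0 _ (mem_nth [::] lt_i2).
- by rewrite /entry /= eq_i.
Qed.

Lemma theta_reverse_tableau gamma U :
  comp_tableau_first_column gamma U -> reverse_tableau (sort_decr gamma) (theta U).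
Proof.
case=> U_tab _; have [[shape_U U_gt0] _ U_sorted _] := U_tab.
split.
- rewrite shape_theta shape_U ?positive_parts_sort_decr //; exact: filter_all.
- apply: all_transpose; apply/allP => _ /mapP[c c_in ->]; rewrite all_sort.
  by apply: (allP (all_transpose U_gt0)).
- exact: theta_rows_sorted.
- rewrite transpose_theta; apply/(all_nthP [::]) => j _.
  rewrite nth_map_sort_decr nth_transpose gtn_sorted_uniq_geq sort_decr_sorted.
  by rewrite sort_uniq (comp_tableau_column_uniq _ U_tab).
Qed.

(** Both sides are transposes of lists of columns. Those of [phi (Theta x)] already decrease, so it
    is enough to match the counts of [phi_count] and [psi_count], which agree because [Theta] only
    permutes each row. *)
Lemma phi_Theta gamma x :
  comp_array_pattern gamma x -> phi (Theta x) = theta (psi x).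
Proof.
move=> cap_x; have GT_x := Theta_GT cap_x.
have [shape_T T_gt0 _ T_cols] := phi_reverse_tableau GT_x.
have [[[_ U_gt0] _ _ _] _] := psi_comp_tableau cap_x.
rewrite -[LHS]transposeK ?shape_T; first 1 last.
- by rewrite positive_parts_sort_decr sort_decr_sorted.
- exact: filter_all.
rewrite /theta; congr transpose.
have sz_T : size (transpose (phi (Theta x))) = size (transpose (psi x)).
  rewrite !size_transpose shape_T (shape_psi cap_x) positive_parts_sort_decr.
  by rewrite (sort_decr_id (sort_decr_sorted _)).
apply: (@eq_from_nth _ [::]) => [|j lt_j]; first by rewrite size_map.
rewrite nth_map_sort_decr !nth_transpose.
have T_j := all_nthP [::] T_cols j lt_j.
rewrite nth_transpose in T_j; rewrite -[LHS](sort_decr_id (sorted_gtn_geq T_j)).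
apply: eq_sort_decr => [||t t_gt0]; rewrite -?nth_transpose.
- by apply: (all_nthP [::] (all_transpose T_gt0)).
- by apply: (all_nthP [::] (all_transpose U_gt0)); rewrite -sz_T.
rewrite !nth_transpose (phi_count _ GT_x) // (psi_count _ cap_x) // nth_Theta.
by rewrite (permP (permEl (perm_sort _ _))).
Qed.

Theorem theorem3p3p5 (n : nat) (gamma : seq nat) (size_gamma : size gamma = n)
    (lambda : seq nat) (lambdaE : lambda = sort_decr gamma) :
  bijection_with_inverse
    (comp_array_pattern_sorting_to lambda) (GT_pattern lambda)
    Theta Theta_inv
  /\ [/\ maps_to (comp_array_pattern gamma) (GT_pattern lambda) Theta,
         maps_to (comp_array_pattern gamma)
           (comp_tableau_first_column gamma) psi,
         maps_to (GT_pattern lambda) (reverse_tableau lambda) phi,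
         maps_to (comp_tableau_first_column gamma)
           (reverse_tableau lambda) theta
       & forall x, comp_array_pattern gamma x -> phi (Theta x) = theta (psi x)].
Proof.
rewrite lambdaE; split; first exact: Theta_bijection.
split.
- exact: Theta_GT.
- exact: psi_comp_tableau.
- exact: phi_reverse_tableau.
- exact: theta_reverse_tableau.
- exact: phi_Theta.
Qed.
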